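(* For every integer $n\ge1$, $$D_n(1,-1,t)=\sum_{k=0}^{n-1}\binom{n-1-k}{k}k!\,t^k.$$
   Context: For $n\in\mathbb{N}$, $[n]_{p,q}=\sum_{i+j=n-1}p^iq^j$ and $\binom{n}{k}_{p,q}=\frac{[n]_{p,q}\cdots[n-k+1]_{p,q}}{[1]_{p,q}\cdots[k]_{p,q}}$. The polynomials $D_n(p,q,t)$ ($n\ge1$) are defined by the formal power series identity $$\sum_{n\ge0}D_{n+1}(p,q,t)x^n=\cfrac{1}{1-[1]_{p,q}x-\cfrac{\binom{2}{2}_{p,q}t\,x^2}{1-[2]_{p,q}x-\cfrac{\binom{3}{2}_{p,q}t\,x^2}{1-[3]_{p,q}x-\cdots}}}$$ (level $m$: $b_m=[m+1]_{p,q}$, $\lambda_m=\binom{m+1}{2}_{p,q}t$). Ordinary binomial coefficients $\binom{a}{k}$ with $k>a$ are $0$. *)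

(* Defs.v *)
From HB Require Import structures.
From mathcomp Require Export all_boot all_order all_algebra.
Set Implicit Arguments.
Unset Strict Implicit.
Unset Printing Implicit Defensive.
Import GRing.Theory.
Local Open Scope ring_scope.

(* A formal power series \sum_n f_n x^n over R is its coefficient function
   f : nat -> R. *)
Section FormalPowerSeries.
Variable R : comNzRingType.
Implicit Types (f g : nat -> R) (b lam : nat -> R).

Definition fps_one : nat -> R := fun n => (n == 0%N)%:R.

Definition fps_mul f g : nat -> R :=
  fun n => \sum_(i < n.+1) f i * g (n - i)%N.

(* The first n coefficients of 1/f, for f with constant term 1; fps_mulV below
   shows that fps_inv f is indeed the inverse of f. *)
Fixpoint fps_inv_upto f (n : nat) : seq R :=
  if n is m.+1 then
    let s := fps_inv_upto f m in
    rcons s (fps_one m - \sum_(i < m) f (m - i)%N * s`_i)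
  else [::].

Definition fps_inv f : nat -> R := fun n => (fps_inv_upto f n.+1)`_n.

(* The series 1 - b_m x - lam_(m+1) x^2 F(x). *)
Definition jfrac_den b lam (m : nat) (F : nat -> R) : nat -> R :=
  fun n => match n with
           | 0 => 1
           | 1 => - b m
           | n'.+2 => - (lam m.+1 * F n')
           end.

(* The continued fraction
     1/(1 - b_m x - lam_(m+1) x^2/(1 - b_(m+1) x - lam_(m+2) x^2/(...)))
   truncated by dropping all levels after m + K. *)
Fixpoint jfrac_conv b lam (K m : nat) : nat -> R :=
  fps_inv (jfrac_den b lam m
    (if K is K'.+1 then jfrac_conv b lam K' m.+1 else fun _ => 0)).

(* The infinite continued fraction, i.e. the x-adic limit of its truncations:
   the coefficient of x^n is the same in all truncations with K >= n
   (jfrac_conv_stable). *)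
Definition jfrac b lam (m : nat) : nat -> R :=
  fun n => jfrac_conv b lam n m n.

Lemma size_fps_inv_upto f n : size (fps_inv_upto f n) = n.
Proof. by elim: n => //= n IH; rewrite size_rcons IH. Qed.

Lemma nth_fps_inv_upto f n i :
  (i < n)%N -> (fps_inv_upto f n)`_i = fps_inv f i.
Proof.
elim: n => // n IH; rewrite ltnS leq_eqVlt => /orP[/eqP -> //|ltin].
by rewrite /= nth_rcons size_fps_inv_upto ltin IH.
Qed.

Lemma fps_invE f n :
  fps_inv f n = fps_one n - \sum_(i < n) f (n - i)%N * fps_inv f i.
Proof.
rewrite {1}/fps_inv /= nth_rcons size_fps_inv_upto ltnn eqxx.
by congr (_ - _); apply: eq_bigr => i _; rewrite nth_fps_inv_upto.
Qed.

Lemma fps_mulV f : f 0%N = 1 -> fps_mul f (fps_inv f) =1 fps_one.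
Proof.
move=> f0 n; rewrite /fps_mul (reindex_inj rev_ord_inj) big_ord_recr /=.
rewrite subSS subnn subn0 f0 mul1r [fps_inv f n]fps_invE.
rewrite addrC -addrA -[RHS]addr0; congr (_ + _); apply/eqP.
rewrite addrC subr_eq0; apply/eqP/eq_bigr => i _.
by rewrite subSS subKn // ltnW.
Qed.

Lemma eq_fps_inv f g n :
  (forall i, (i <= n)%N -> f i = g i) -> fps_inv f n = fps_inv g n.
Proof.
elim/ltn_ind: n => n IH fg; rewrite !fps_invE; congr (_ - _).
apply: eq_bigr => i _; rewrite fg ?leq_subr //; congr (_ * _).
apply: IH => // j leji; apply: fg.
exact: leq_trans leji (ltnW (ltn_ord i)).
Qed.

Lemma jfrac_conv_stable b lam K m n :
  (n <= K)%N -> jfrac_conv b lam K m n = jfrac b lam m n.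
Proof.
rewrite /jfrac; elim/ltn_ind: n K m => n IH [|K] m lenK.
  by move: lenK; rewrite leqn0 => /eqP ->.
case: n IH lenK => [|n] IH lenK /=; apply: eq_fps_inv => -[|[|i]] //= lein.
have ltin : (i < n)%N by [].
have leiK : (i <= K)%N by exact: leq_trans (ltnW ltin) lenK.
by rewrite !(IH i) // ltnW.
Qed.

Lemma jfracE b lam m :
  jfrac b lam m =1 fps_inv (jfrac_den b lam m (jfrac b lam m.+1)).
Proof.
move=> n; rewrite -(@jfrac_conv_stable b lam n.+1) //=.
apply: eq_fps_inv => -[|[|i]] //= lein.
by rewrite jfrac_conv_stable // ltnW // ltnW.
Qed.

End FormalPowerSeries.

(* Z[p, q] is {poly {poly int}}: the inner variable is p, the outer one q. *)
Notation Zpq := {poly {poly int}}.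
Definition p_ : Zpq := 'X%:P.
Definition q_ : Zpq := 'X.

Definition pqint (n : nat) : Zpq := \sum_(i < n) p_ ^+ i * q_ ^+ (n.-1 - i).

Definition pqbinom_num (n k : nat) : Zpq := \prod_(i < k) pqint (n - i).
Definition pqbinom_den (k : nat) : Zpq := \prod_(i < k) pqint i.+1.

(* The division is exact in Z[p, q] (pqbinomK), and the denominator is monic
   in q. *)
Definition pqbinom (n k : nat) : Zpq :=
  pqbinom_num n k %/ pqbinom_den k.

Lemma pqintD a b : pqint (a + b) = p_ ^+ a * pqint b + q_ ^+ b * pqint a.
Proof.
rewrite /pqint big_split_ord /= addrC; congr (_ + _); rewrite mulr_sumr.
  apply: eq_bigr => i _; rewrite mulrA -exprD; congr (_ * _ ^+ _).
  by case: b i => [[]//|b] i; rewrite addnS /= subnDl.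
apply: eq_bigr => i _; rewrite mulrCA -exprD; congr (_ * _ ^+ _).
by case: a i => [[]//|a] i /=; rewrite [RHS]addnBA -1?ltnS // addnC.
Qed.

Lemma size_pqint n : (size (pqint n) <= n)%N.
Proof.
apply: (leq_trans (size_sum _ _ _)); apply/bigmax_leqP => i _.
rewrite /p_ /q_ -rmorphXn /= mul_polyC (leq_trans (size_scale_leq _ _)) //.
rewrite size_polyXn; have := ltn_ord i; case: n i => [[]//|n] i _ /=.
by rewrite ltnS leq_subr.
Qed.

Lemma pqint_monic n : pqint n.+1 \is monic.
Proof.
rewrite -add1n pqintD expr1 {2}/pqint big_ord1 !expr0 !mulr1 monicE addrC.
rewrite lead_coefDl ?lead_coefXn // size_polyXn /p_ mul_polyC ltnS.
exact: leq_trans (size_scale_leq _ _) (size_pqint n).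
Qed.

Lemma pqbinom_den_monic k : pqbinom_den k \is monic.
Proof. by apply: monic_prod => i _; apply: pqint_monic. Qed.

Lemma pqbinomK n k : pqbinom n k * pqbinom_den k = pqbinom_num n k.
Proof.
suff [B HB] : exists B, pqbinom_num n k = B * pqbinom_den k.
  rewrite /pqbinom HB Pdiv.IdomainMonic.mulpK //; exact: pqbinom_den_monic.
elim: n k => [|n IH] [|k]; try by exists 1;
  rewrite /pqbinom_num /pqbinom_den !big_ord0 mulr1.
  by exists 0; rewrite mul0r /pqbinom_num big_ord_recl /pqint big_ord0 mul0r.
have numS : pqbinom_num n.+1 k.+1 = pqint n.+1 * pqbinom_num n k.
  by rewrite /pqbinom_num big_ord_recl.
have denS : pqbinom_den k.+1 = pqbinom_den k * pqint k.+1.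
  by rewrite /pqbinom_den big_ord_recr.
have [ltnk|lekn] := ltnP n k.
  exists 0; rewrite mul0r numS /pqbinom_num (bigD1 (Ordinal ltnk)) //=.
  by rewrite subnn /pqint [X in _ * (X * _)]big_ord0 mul0r mulr0.
have [B HB] := IH k; have [C HC] := IH k.+1.
exists (p_ ^+ (n - k) * B + q_ ^+ k.+1 * C).
have -> : pqbinom_num n.+1 k.+1 =
    p_ ^+ (n - k) * (pqbinom_num n k * pqint k.+1) +
    q_ ^+ k.+1 * pqbinom_num n k.+1.
  have -> : pqbinom_num n k.+1 = pqbinom_num n k * pqint (n - k).
    by rewrite /pqbinom_num big_ord_recr.
  rewrite numS -{1}(subnK lekn) -addnS pqintD mulrDl -!mulrA.
  by congr (_ * _ + _ * _); rewrite mulrC.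
by rewrite HB HC denS mulrDl !mulrA.
Qed.

(* D_n(p, q, t) as an element of Z[p, q][t], meaningful for n >= 1. *)
Definition Dpoly (n : nat) : {poly Zpq} :=
  jfrac (fun m => (pqint m.+1)%:P) (fun m => (pqbinom m.+1 2)%:P * 'X) 0 n.-1.

(* D_n(a, b, t) as an element of Z[t]. *)
Definition Dpoly_at (n : nat) (a b : int) : {poly int} :=
  map_poly (fun c : Zpq => c.[b%:P].[a]) (Dpoly n).

(* Main.v *)
Require Import Defs.
From mathcomp Require Import all_boot all_order all_algebra.
From mathcomp Require Import ring zify.
Set Implicit Arguments.
Unset Strict Implicit.
Unset Printing Implicit Defensive.
Import GRing.Theory.
Local Open Scope ring_scope.

(** Euler's method.  Writing (a)_k = a (a + 1) ... (a + k - 1), the series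
      2F0(a, b; y) = \sum_k (a)_k (b)_k / k! y^k
    satisfy the contiguity relations
      2F0(a, b + 1) - 2F0(a, b) = a y 2F0(a + 1, b + 1),
      2F0(a + 1, b) - 2F0(a, b) = b y 2F0(a + 1, b + 1).
    For y = t x^2 / (1 - u x) they show that the series
      S_(2j)   = (1 - u x)^(-j)   2F0(a + j, j; y),
      S_(2j+1) = (1 - u x)^(-j-1) 2F0(a + j, j + 1; y)
    satisfy S_m = (1 - b_m x) S_(m+1) - lam_(m+1) x^2 S_(m+2), where b_m is
    u, 0, u, 0, ... and lam_m is a t, t, (a + 1) t, 2 t, (a + 2) t, 3 t, ...
    Hence the m-th tail of the continued fraction is S_(m+1) / S_m, and since
    S_0 = 1 the whole fraction is
      S_1 = \sum_k (a)_k t^k x^(2k) / (1 - u x)^(k+1).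
    At (p, q) = (1, -1) the fraction defining D_n is the case a = u = 1. *)

Section PowerSeries.
Variable R : comNzRingType.
Implicit Types f g h : nat -> R.

Lemma eq_fps_mul f f' g g' n :
    (forall i, (i <= n)%N -> f i = f' i) ->
    (forall i, (i <= n)%N -> g i = g' i) ->
  fps_mul f g n = fps_mul f' g' n.
Proof.
by move=> ff' gg'; apply: eq_bigr => i _; rewrite ff' ?gg' ?leq_subr ?leq_ord.
Qed.

Lemma fps_mul_poly f g N n : (n < N)%N ->
  fps_mul f g n = (\poly_(i < N) f i * \poly_(i < N) g i)`_n.
Proof.
move=> ltnN; rewrite coefM; apply: eq_bigr => i _.
by have lein := ltn_ord i; rewrite !coef_poly !ifT //; lia.
Qed.

Lemma fps_mulC f g : fps_mul f g =1 fps_mul g f.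
Proof. by move=> n; rewrite !(@fps_mul_poly _ _ n.+1) // mulrC. Qed.

Lemma fps_mulA f g h :
  fps_mul f (fps_mul g h) =1 fps_mul (fps_mul f g) h.
Proof.
move=> n; pose trunc f := \poly_(i < n.+1) f i.
transitivity ((trunc f * trunc g * trunc h)`_n).
  rewrite -mulrA coefM; apply: eq_bigr => i _.
  by rewrite (@fps_mul_poly _ _ n.+1) ?coef_poly ?ltn_ord //; lia.
rewrite coefM; apply: eq_bigr => i _.
by rewrite (@fps_mul_poly _ _ n.+1) // coef_poly ifT //; lia.
Qed.

Lemma fps_mul1f f : fps_mul (@fps_one R) f =1 f.
Proof.
move=> n; rewrite /fps_mul big_ord_recl /= mul1r subn0 big1 ?addr0 // => i _.
by rewrite /fps_one mul0r.
Qed.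

Lemma fps_inv_mulK f g h n : f 0%N = 1 ->
    (forall i, (i <= n)%N -> fps_mul f g i = h i) ->
  fps_mul (fps_inv f) h n = g n.
Proof.
move=> f0 fg.
rewrite (@eq_fps_mul _ (fps_inv f) _ (fps_mul f g)) // => [|i /fg //].
rewrite fps_mulA -[RHS]fps_mul1f; apply: eq_fps_mul => // i _.
by rewrite fps_mulC fps_mulV.
Qed.

Fixpoint fps_mulXn (k : nat) f (n : nat) : R :=
  match k, n with
  | 0, _ => f n
  | _.+1, 0 => 0
  | k'.+1, n'.+1 => fps_mulXn k' f n'
  end.

Lemma fps_mulXnE k f n :
  fps_mulXn k f n = if (k <= n)%N then f (n - k)%N else 0.
Proof. by elim: k n => [|k IH] [|n] //=; rewrite IH. Qed.

Lemma fps_mulXnD k l f : fps_mulXn k (fps_mulXn l f) =1 fps_mulXn (k + l) f.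
Proof. by elim: k => // k IH [|n] /=. Qed.

Lemma fps_mulXn_lin k f g h c : (forall n, h n = f n + c * g n) ->
  forall n, fps_mulXn k h n = fps_mulXn k f n + c * fps_mulXn k g n.
Proof.
by move=> hE n; rewrite !fps_mulXnE; case: ifP; rewrite // mulr0 addr0.
Qed.

End PowerSeries.

Section ContinuedFraction.
Variable R : comNzRingType.
Implicit Types b lam : nat -> R.

Lemma fps_mul_jfrac_den b lam m g h n :
  fps_mul (jfrac_den b lam m g) h n =
  h n - b m * fps_mulXn 1 h n - lam m.+1 * fps_mulXn 2 (fps_mul g h) n.
Proof.
rewrite /fps_mul; case: n => [|[|n]] /=.
- by rewrite big_ord1 mul1r !mulr0 !subr0.
- by rewrite big_ord_recr big_ord1 /= mul1r mulr0 subr0 mulNr.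
rewrite 2!big_ord_recl /= mul1r subn0 addrA mulNr subn1 /=; congr (_ + _).
rewrite mulr_sumr -sumrN; apply: eq_bigr => i _.
by rewrite /= /bump /= !add1n !subSS mulNr mulrA.
Qed.

Lemma fps_mul_jfrac b lam (S : nat -> nat -> R) :
    (forall m n, S m.+1 n = S m n + b m * fps_mulXn 1 (S m.+1) n
       + lam m.+1 * fps_mulXn 2 (S m.+2) n) ->
  forall m, fps_mul (jfrac b lam m) (S m) =1 S m.+1.
Proof.
move=> S_rec m n; elim/ltn_ind: n m => n IH m.
rewrite (eq_fps_mul (fun i _ => jfracE b lam m i) (fun _ _ => erefl)).
apply: fps_inv_mulK => // i lein; rewrite fps_mul_jfrac_den.
suff -> : fps_mulXn 2 (fps_mul (jfrac b lam m.+1) (S m.+1)) i =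
          fps_mulXn 2 (S m.+2) i by rewrite S_rec; ring.
by case: i lein => [|[|i]] //= lein; rewrite IH // ltnW.
Qed.

Lemma eq_jfrac b b' lam lam' : b =1 b' -> lam =1 lam' ->
  forall m, jfrac b lam m =1 jfrac b' lam' m.
Proof.
move=> eqb eqlam m n; rewrite /jfrac; move: {1 3}n => K.
elim: K m n => [|K IH] m n /=; apply: eq_fps_inv => -[|[|i]] _ //=;
  by rewrite ?eqb ?eqlam ?IH.
Qed.

End ContinuedFraction.

Section ContinuedFractionMorphism.
Variables (R R' : comNzRingType) (phi : {rmorphism R -> R'}).

Lemma rmorph_fps_inv (f : nat -> R) n :
  phi (fps_inv f n) = fps_inv (phi \o f) n.
Proof.
elim/ltn_ind: n => n IH; rewrite !fps_invE rmorphB rmorph_sum /=.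
congr (_ - _); first by rewrite /fps_one rmorph_nat.
by apply: eq_bigr => i _; rewrite rmorphM IH.
Qed.

Lemma rmorph_jfrac (b lam : nat -> R) m n :
  phi (jfrac b lam m n) = jfrac (phi \o b) (phi \o lam) m n.
Proof.
rewrite /jfrac; move: {1 3}n => K; elim: K m n => [|K IH] m n /=;
  rewrite rmorph_fps_inv; apply: eq_fps_inv => -[|[|i]] _ /=;
  by rewrite ?rmorph1 ?rmorphN ?rmorphM ?rmorph0 ?IH.
Qed.

End ContinuedFractionMorphism.

(* The predecessor is truncated only at n = k = 0, where the value 1 is the
   right one. *)
Definition multichoose (n k : nat) : nat := 'C((n + k).-1, k).

Lemma multichoosen0 n : multichoose n 0 = 1%N.
Proof. exact: bin0. Qed.

Lemma multichoose0n k : multichoose 0 k = (k == 0%N).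
Proof. by case: k => // k; rewrite /multichoose bin_small. Qed.

Lemma multichoose1n k : multichoose 1 k = 1%N.
Proof. exact: binn. Qed.

Lemma multichooseS n k :
  multichoose n.+1 k.+1 = (multichoose n k.+1 + multichoose n.+1 k)%N.
Proof. by rewrite /multichoose !addnS addSn /= binS. Qed.

Lemma mul_multichoose_diag n k :
  (k.+1 * multichoose n k.+1 = n * multichoose n.+1 k)%N.
Proof. by rewrite /multichoose addnS addSn /= mul_bin_left addnK. Qed.

Section Hypergeometric.
Variable R : comNzRingType.
Implicit Types a : R.

Definition rising a (k : nat) : R := \prod_(i < k) (a + i%:R).

Lemma risingSl a k : rising a k.+1 = a * rising (a + 1) k.
Proof.
rewrite /rising big_ord_recl addr0; congr (_ * _); apply: eq_bigr => i _.
by rewrite -addrA -natr1 [_ + 1]addrC.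
Qed.

Lemma risingSr a k : rising a k.+1 = rising a k * (a + k%:R).
Proof. exact: big_ord_recr. Qed.

Lemma rising1 k : rising 1 k = k`!%:R.
Proof.
elim: k => [|k IH]; first exact: big_ord0.
by rewrite risingSr IH factS mulnC natrM nat1r.
Qed.

Definition hyp2F0 a (b : nat) : nat -> R :=
  fun k => rising a k * (multichoose b k)%:R.

Lemma hyp2F0_contiguous_right a b k :
  hyp2F0 a b.+1 k = hyp2F0 a b k + a * fps_mulXn 1 (hyp2F0 (a + 1) b.+1) k.
Proof.
rewrite /hyp2F0; case: k => [|k] /=.
  by rewrite !multichoosen0 mulr0 addr0.
by rewrite multichooseS natrD mulrDr [in X in _ + X]risingSl mulrA.
Qed.

Lemma hyp2F0_contiguous_left a b k :
  hyp2F0 (a + 1) b k =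
  hyp2F0 a b k + b%:R * fps_mulXn 1 (hyp2F0 (a + 1) b.+1) k.
Proof.
rewrite /hyp2F0; case: k => [|k] /=.
  by rewrite /rising !big_ord0 mulr0 addr0.
have diag : k.+1%:R * (multichoose b k.+1)%:R =
            b%:R * (multichoose b.+1 k)%:R :> R.
  by rewrite -!natrM mul_multichoose_diag.
by rewrite mulrCA -diag [rising a _]risingSl risingSr -natr1; ring.
Qed.

End Hypergeometric.

Section EulerFraction.
Variables (R : comNzRingType) (u t : R).
Implicit Types c d : nat -> R.

(* The coefficients of (1 - u x)^(-r). *)
Definition geom_exp (r n : nat) : R := u ^+ n * (multichoose r n)%:R.

Lemma geom_expS r n :
  geom_exp r.+1 n = geom_exp r n + u * fps_mulXn 1 (geom_exp r.+1) n.
Proof.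
rewrite /geom_exp; case: n => [|n] /=.
  by rewrite !multichoosen0 mulr0 addr0.
by rewrite multichooseS natrD mulrDr exprS mulrA.
Qed.

(* The coefficients of (1 - u x)^(-r) c(t x^2 / (1 - u x)). *)
Definition fps_subst (r : nat) c : nat -> R := fun n =>
  \sum_(k < n.+1) c k * t ^+ k * fps_mulXn k.*2 (geom_exp (k + r)) n.

Lemma fps_subst_widen r c n N : (n < N)%N ->
  fps_subst r c n =
  \sum_(k < N) c k * t ^+ k * fps_mulXn k.*2 (geom_exp (k + r)) n.
Proof.
move=> ltnN; rewrite -(subnKC ltnN) big_split_ord.
rewrite -[LHS]addr0; congr (_ + _); rewrite big1 // => k _.
by rewrite fps_mulXnE ifF ?mulr0 //=; lia.
Qed.

Lemma eq_fps_subst r c d : c =1 d -> fps_subst r c =1 fps_subst r d.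
Proof. by move=> eqcd n; apply: eq_bigr => k _; rewrite eqcd. Qed.

Lemma fps_substS r c n :
  fps_subst r.+1 c n = fps_subst r c n + u * fps_mulXn 1 (fps_subst r.+1 c) n.
Proof.
have shiftS k m : fps_mulXn k.*2 (geom_exp (k + r.+1)) m =
    fps_mulXn k.*2 (geom_exp (k + r)) m +
    u * fps_mulXn 1 (fps_mulXn k.*2 (geom_exp (k + r.+1))) m.
  by rewrite addnS (fps_mulXn_lin _ (geom_expS _)) !fps_mulXnD addn1 add1n.
case: n => [|n] /=.
  by rewrite /fps_subst !big_ord1 shiftS /= !mulr0 !addr0.
rewrite (fps_subst_widen _ _ (leqnSn n.+1)) mulr_sumr -big_split.
by apply: eq_bigr => k _; rewrite shiftS mulrDr mulrCA.
Qed.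

Lemma fps_subst_mulX r c d v n :
  fps_subst r (fun k => c k + v * fps_mulXn 1 d k) n =
  fps_subst r c n + v * t * fps_mulXn 2 (fps_subst r.+1 d) n.
Proof.
transitivity (fps_subst r c n + v * fps_subst r (fps_mulXn 1 d) n).
  rewrite mulr_sumr -big_split; apply: eq_bigr => k _ /=.
  by rewrite !mulrDl !mulrA.
congr (_ + _); rewrite -mulrA; congr (_ * _).
rewrite /fps_subst big_ord_recl mul0r mul0r add0r.
case: n => [|[|n]] /=; first by rewrite big_ord0 mulr0.
  by rewrite big_ord1 /= !mulr0.
rewrite -/(fps_subst _ _ _) (fps_subst_widen _ _ (leqnSn n.+1)) mulr_sumr.
apply: eq_bigr => k _; rewrite /= add0n addSnnS exprS; ring.
Qed.

Variable a : R.

Definition euler_series (m : nat) : nat -> R :=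
  fps_subst (uphalf m) (hyp2F0 (a + m./2%:R) (uphalf m)).

Lemma euler_series_rec m n :
  euler_series m.+1 n =
  euler_series m n + (u *+ ~~ odd m) * fps_mulXn 1 (euler_series m.+1) n
  + (a *+ odd m.+1 + m.+1./2%:R) * t * fps_mulXn 2 (euler_series m.+2) n.
Proof.
have addrS j : a + j.+1%:R = a + j%:R + 1 by rewrite -addrA natr1.
rewrite /euler_series [uphalf m.+2]/= [m.+2./2]/= addrS.
have [odd_m|even_m] := boolP (odd m).
  rewrite /= odd_m uphalf_half odd_m !mulr0n mul0r addr0 add0r add1n addrS.
  rewrite -fps_subst_mulX; apply: eq_fps_subst => k.
  exact: hyp2F0_contiguous_left.
rewrite /= even_m uphalf_half (negPf even_m) !add0n !mulr1n fps_substS.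
rewrite addrAC; congr (_ + _); rewrite -fps_subst_mulX.
by apply: eq_fps_subst => k; apply: hyp2F0_contiguous_right.
Qed.

Lemma euler_series0 : euler_series 0 =1 @fps_one R.
Proof.
move=> n; rewrite /euler_series /fps_subst big_ord_recl big1 => [|k _].
  rewrite /hyp2F0 /geom_exp /rising big_ord0 /= !multichoose0n !mul1r addr0.
  by rewrite /fps_one; case: n => [|n]; rewrite ?mul1r ?mulr0.
by rewrite /hyp2F0 multichoose0n mulr0 !mul0r.
Qed.

Lemma euler_series1 n :
  euler_series 1 n =
  \sum_(k < n.+1) rising a k * t ^+ k * (u ^+ (n - k.*2) *+ 'C(n - k, k)).
Proof.
apply: eq_bigr => k _; rewrite /hyp2F0 multichoose1n mulr1 addr0; congr (_ * _).
rewrite fps_mulXnE; case: leqP => [le2kn|lt]; last first.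
  by rewrite bin_small ?mulr0n //; lia.
rewrite /geom_exp /multichoose mulr_natr -bin_sub; last by lia.
by congr (_ *+ 'C(_, _)); lia.
Qed.

Lemma jfrac_euler n :
  jfrac (fun m => u *+ ~~ odd m) (fun m => (a *+ odd m + m./2%:R) * t) 0 n =
  \sum_(k < n.+1) rising a k * t ^+ k * (u ^+ (n - k.*2) *+ 'C(n - k, k)).
Proof.
pose lam m := (a *+ odd m + m./2%:R) * t.
rewrite -euler_series1 -(fps_mul_jfrac (lam := lam) euler_series_rec).
rewrite -[LHS]fps_mul1f fps_mulC.
by apply: eq_fps_mul => // i _; rewrite euler_series0.
Qed.

End EulerFraction.

Lemma pqint1 : pqint 1 = 1.
Proof. by rewrite /pqint big_ord1 !expr0 mulr1. Qed.

Lemma pqbinom_small n k : (n < k)%N -> pqbinom n k = 0.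
Proof.
move=> ltnk; rewrite /pqbinom /pqbinom_num (bigD1 (Ordinal ltnk)) //= subnn.
by rewrite /pqint [X in X * _]big_ord0 mul0r div0p.
Qed.

Lemma pqbinom1 n : pqbinom n 1 = pqint n.
Proof.
by rewrite /pqbinom /pqbinom_num /pqbinom_den !big_ord1 subn0 pqint1 divp1.
Qed.

Lemma pqbinomS n k :
  pqbinom n.+1 k.+1 =
  p_ ^+ (n - k) * pqbinom n k + q_ ^+ k.+1 * pqbinom n k.+1.
Proof.
have [ltnk|lekn] := ltnP n k.
  rewrite (pqbinom_small ltnk) (@pqbinom_small n.+1 k.+1 ltnk).
  by rewrite (@pqbinom_small n k.+1 (ltnW ltnk)) !mulr0 addr0.
apply: (mulIf (monic_neq0 (pqbinom_den_monic k.+1))).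
have denS : pqbinom_den k.+1 = pqbinom_den k * pqint k.+1.
  exact: big_ord_recr.
have numSl : pqbinom_num n.+1 k.+1 = pqint n.+1 * pqbinom_num n k.
  exact: big_ord_recl.
have numSr : pqbinom_num n k.+1 = pqbinom_num n k * pqint (n - k).
  exact: big_ord_recr.
rewrite mulrDl -[q_ ^+ _ * _ * _]mulrA !pqbinomK numSl numSr denS.
rewrite -{1}(subnK lekn) -addnS pqintD -(pqbinomK n k); ring.
Qed.

Section Specialization.
Variables a b : int.

Definition pqeval : {rmorphism Zpq -> int} :=
  horner_eval a \o horner_eval b%:P.

Lemma pqeval_p : pqeval p_ = a.
Proof. by rewrite /= /horner_eval /p_ hornerC hornerX. Qed.

Lemma pqeval_q : pqeval q_ = b.
Proof. by rewrite /= /horner_eval /q_ hornerX hornerC. Qed.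

Lemma Dpoly_atE n :
  Dpoly_at n a b =
  jfrac (fun m => (pqeval (pqint m.+1))%:P)
        (fun m => (pqeval (pqbinom m.+1 2))%:P * 'X) 0 n.-1.
Proof.
rewrite -[LHS]/(map_poly pqeval _) rmorph_jfrac; apply: eq_jfrac => m.
  exact: map_polyC.
by apply: etrans (rmorphM _ _ _) _; rewrite /= map_polyC map_polyX.
Qed.

End Specialization.

Lemma pqeval_1N1_pqint n : pqeval 1 (-1) (pqint n) = (odd n)%:R.
Proof.
elim: n => [|n IH]; first by rewrite /pqint big_ord0 rmorph0.
rewrite -addn1 pqintD pqint1 rmorphD !rmorphM !rmorphXn pqeval_p pqeval_q IH.
by rewrite rmorph1 expr1n addn1 /=; case: (odd n).
Qed.

Lemma pqeval_1N1_pqbinom2 n : pqeval 1 (-1) (pqbinom n 2) = n./2%:R.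
Proof.
elim: n => [|n IH]; first by rewrite pqbinom_small ?rmorph0.
rewrite pqbinomS pqbinom1 rmorphD !rmorphM !rmorphXn pqeval_p pqeval_q IH.
rewrite pqeval_1N1_pqint expr1n mul1r mulrNN !mul1r -natrD.
by congr _%:R; lia.
Qed.

Theorem theorem3p7 (n : nat) (hn : (1 <= n)%N) :
  Dpoly_at n 1 (-1) =
  \sum_(0 <= k < n) ('C(n - 1 - k, k) * k`!)%:R *: 'X^k.
Proof.
case: n hn => // n _; rewrite subn1 big_mkord /= Dpoly_atE.
transitivity (jfrac (fun m => 1 *+ ~~ odd m)
  (fun m => (1 *+ odd m + m./2%:R) * 'X) 0 n : {poly int}).
  apply: eq_jfrac => m; first by rewrite pqeval_1N1_pqint polyC_natr.
  by rewrite pqeval_1N1_pqbinom2 polyC_natr -natrD -uphalf_half.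
rewrite jfrac_euler; apply: eq_bigr => k _.
by rewrite rising1 expr1n -mul_polyC polyC_natr natrM; ring.
Qed.
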